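(* Let $B$ be a non-empty binary tree and let $S\in\{\mathrm{inv},\mathrm{imaj}\}$. Then $$\sum_{T\in\mathrm{NAT}(B)} q_L^{S(\sigma_L(T))}\,q_R^{S(\sigma_R(T))}=\frac{[\,|\mathrm{LV}(B)|\,]_{q_L}!\;[\,|\mathrm{RV}(B)|\,]_{q_R}!}{\displaystyle\prod_{U\text{ left child}}[E_L(U)]_{q_L}\cdot\prod_{U\text{ right child}}[E_R(U)]_{q_R}}.$$
   Context: A binary tree is a rooted tree in which each vertex has either no child, a left child, a right child, or both; $\mathrm{LV}(B)$ (resp. $\mathrm{RV}(B)$) is its set of left (resp. right) children (the root is in neither). A non-ambiguous tree (NAT) of shape $B$ is a labelling of the left children of $B$ bijectively by $1,\dots,|\mathrm{LV}(B)|$ and of the right children bijectively by $1,\dots,|\mathrm{RV}(B)|$ such that whenever $U,V$ are both left children (resp. both right children) and $U$ is a proper ancestor of $V$, the label of $U$ exceeds that of $V$; $\mathrm{NAT}(B)$ is the set of NATs of shape $B$. For a NAT $T$, $\sigma_L(T)$ is the word of left labels obtained by the recursive reading: for a subtree with root $r$, left subtree $L$ and right subtree $R$, read (recursively) $L$, then $R$, then the left label of $r$ if $r$ is a left child (the root of $T$ itself is not read); it is a permutation of $\{1,\dots,|\mathrm{LV}(B)|\}$. $\sigma_R(T)$ is the word of right labels obtained by reading recursively $R$, then $L$, then the right label of $r$ if $r$ is a right child; it is a permutation of $\{1,\dots,|\mathrm{RV}(B)|\}$. For a permutation $\sigma$ of $\{1,\dots,n\}$, $\mathrm{inv}(\sigma)$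 is the number of pairs $i<j$ with $\sigma(i)>\sigma(j)$, and $\mathrm{imaj}(\sigma)$ is the sum of the descents of $\sigma^{-1}$ (a descent of $\tau$ is an $i<n$ with $\tau(i)>\tau(i+1)$). For a left (resp. right) child $U$, $E_L(U)$ (resp. $E_R(U)$) is the number of left (resp. right) children in the subtree rooted at $U$, $U$ included. $[n]_q=\frac{1-q^n}{1-q}$ and $[n]_q!=\prod_{i=1}^n[i]_q$; $q_L,q_R$ are formal variables. *)

(* Defs.v *)
From HB Require Import structures.
From mathcomp Require Import all_boot all_order all_algebra.
From mathcomp Require Import mpoly.

Set Implicit Arguments.
Unset Strict Implicit.
Unset Printing Implicit Defensive.

Import GRing.Theory.

(* A child is either a subtree or absent; [Empty] encodes absence, so that the *)
(* non-empty binary trees are the values other than [Empty].                   *)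
Inductive bintree := Empty | Node of bintree & bintree.

(* A vertex is the sequence of directions leading to it from the root.         *)
Definition vertex := seq bool.
Definition lft : bool := false.
Definition rgt : bool := true.

Fixpoint vertices (B : bintree) : seq vertex :=
  if B is Node l r then
    [::] :: map (cons lft) (vertices l) ++ map (cons rgt) (vertices r)
  else [::].

Definition is_child (d : bool) (u : vertex) : bool :=
  (u != [::]) && (last d u == d).

Definition children (d : bool) (B : bintree) : finType :=
  seq_sub [seq u <- vertices B | is_child d u].

Notation LV := (children lft).
Notation RV := (children rgt).

Definition proper_ancestor (u v : vertex) : bool := prefix u v && (u != v).

(* The ordinal [i] stands for the label [i + 1].                               *)
Definition labelling (d : bool) (B : bintree) : finType :=
  {ffun children d B -> 'I_#|children d B|}.

Definition decreasing_bijection d B (f : labelling d B) : bool :=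
  [&& injectiveb f, [forall i, exists u, f u == i] &
      [forall u, forall v,
         proper_ancestor (ssval u) (ssval v) ==> (f v < f u)%N]].

Definition NAT (B : bintree) : {set labelling lft B * labelling rgt B} :=
  [set T | decreasing_bijection T.1 && decreasing_bijection T.2].

(* The default value 0 is never reached on the children of direction [d].      *)
Definition label d B (f : labelling d B) (u : vertex) : nat :=
  if insub u is Some v then (f v).+1 else 0.

(* Reading of the subtree [B] rooted at the vertex [u]: first the subtree in   *)
(* direction [d], then the other one, then [u] if it is a child of direction   *)
(* [d].                                                                        *)
Fixpoint reading (d : bool) (u : vertex) (B : bintree) : seq vertex :=
  if B is Node l r then
    let readl := reading d (rcons u lft) l in
    let readr := reading d (rcons u rgt) r in
    (if d == lft then readl ++ readr else readr ++ readl)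
      ++ (if is_child d u then [:: u] else [::])
  else [::].

Definition sigmaL B (T : labelling lft B * labelling rgt B) : seq nat :=
  map (label T.1) (reading lft [::] B).
Definition sigmaR B (T : labelling lft B * labelling rgt B) : seq nat :=
  map (label T.2) (reading rgt [::] B).

(* A permutation s of {1, ..., n} is the word s(1) ... s(n), so that s(i) is   *)
(* [nth 0 s i.-1].                                                             *)
Definition inversions (s : seq nat) : nat :=
  #|[set p : 'I_(size s) * 'I_(size s) |
      (p.1 < p.2) && (nth 0 s p.2 < nth 0 s p.1)]|.

Definition inverse (s : seq nat) : seq nat :=
  [seq (index k s).+1 | k <- iota 1 (size s)].

Definition is_descent (t : seq nat) (i : nat) : bool :=
  nth 0 t i < nth 0 t i.-1.

Definition imaj (s : seq nat) : nat :=
  \sum_(1 <= i < size s | is_descent (inverse s) i) i.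

(* Number of children of direction [d] in the subtree rooted at [u].           *)
Definition E d B (u : children d B) : nat :=
  #|[set v : children d B | prefix (ssval u) (ssval v)]|.

Local Open Scope ring_scope.

Definition qint (F : fieldType) (q : F) (n : nat) : F := (1 - q ^+ n) / (1 - q).
Definition qfact (F : fieldType) (q : F) (n : nat) : F :=
  \prod_(1 <= i < n.+1) qint q i.

(* The field of rational functions in the formal variables qL and qR.          *)
Definition ratfun : fieldType := {fraction {mpoly int[2]}}.
Definition qL : ratfun := tofrac ('X_(ord0) : {mpoly int[2]}).
Definition qR : ratfun := tofrac ('X_(ord_max) : {mpoly int[2]}).

(* Main.v *)
Require Import Defs.
From HB Require Import structures.
From mathcomp Require Import all_boot all_order all_algebra.
From mathcomp Require Import mpoly.
From mathcomp Require Import ring zify.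

(* A NAT is a pair of independent labellings, one of the left children and    *)
(* one of the right children, so the sum is a product of two sums of the same *)
(* form. For a fixed direction, record a labelling by the word w of its       *)
(* vertices in order of decreasing label. If h is the position in the reading *)
(* order, then h(w) is sigma^-1 reversed, so inv(sigma) and imaj(sigma) are   *)
(* the inversion number and the major index of h(w) read backwards. The words *)
(* of a subtree are the shuffles of the words of its two branches, preceded   *)
(* by the root when it is itself a child of the direction considered. Reading *)
(* one branch entirely before the other makes the alphabets separated, so     *)
(* that shuffling multiplies the generating function by a q-binomial          *)
(* coefficient (Garsia-Gessel for maj), while the root changes neither        *)
(* statistic. The hook formula follows by induction on the tree.              *)

Set Implicit Arguments.
Unset Strict Implicit.
Unset Printing Implicit Defensive.

Import GRing.Theory.
Local Open Scope ring_scope.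

(** This is a q-analogue, in the style of Björner and Wachs, of the hook formula for linear
    extensions of a forest, applied once to the left children and once to the right children.
    [word_labelling] is a bijection from the linear extensions in [linexts] to the decreasing
    labellings, and [inversions_inv_rev] and [imaj_maj_rev] carry the two statistics over to words.

    The hook formula holds because everything is multiplicative. If two branches with m and n
    counted vertices have generating functions [m]!/P and [n]!/P', shuffling multiplies their
    product by [m+n]!/([m]![n]!) ([sum_shuffle_inv], [sum_shuffle_maj]), which leaves [m+n]!/(PP').
    A root that is itself counted has hook m+n+1, so numerator and denominator both gain [m+n+1].
    This agrees with the words: the root comes first in the word and last in the reading, hence adds
    nothing to either statistic. [sum_linexts] is this induction, for any statistic with these
    properties. *)

(** * Shuffles of two words *)

Fixpoint shuffle (T : Type) (u : seq T) : seq T -> seq (seq T) :=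
  if u is a :: u' then
    fix shuffle_u v :=
      if v is b :: v' then
        [seq a :: s | s <- shuffle u' v] ++ [seq b :: s | s <- shuffle_u v']
      else [:: u]
  else fun v => [:: v].

Lemma shuffle_nilr (T : Type) (u : seq T) : shuffle u [::] = [:: u].
Proof. by case: u. Qed.

Lemma shuffle_cons (T : Type) a b (u v : seq T) :
  shuffle (a :: u) (b :: v) =
  [seq a :: s | s <- shuffle u (b :: v)]
    ++ [seq b :: s | s <- shuffle (a :: u) v].
Proof. by []. Qed.

Lemma shuffle_ind (T : Type) (P : seq T -> seq T -> Prop) :
    (forall v, P [::] v) -> (forall u, P u [::]) ->
    (forall a u b v, P u (b :: v) -> P (a :: u) v -> P (a :: u) (b :: v)) ->
  forall u v, P u v.
Proof.
move=> Pl Pr Pc; elim=> [|a u IHu]; first exact: Pl.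
by elim=> [|b v IHv]; [exact: Pr | exact: Pc].
Qed.

Lemma map_shuffle (T T' : Type) (h : T -> T') u v :
  [seq map h s | s <- shuffle u v] = shuffle (map h u) (map h v).
Proof.
move: u v; apply: shuffle_ind => // [u|a u b v IHu IHv]; first by rewrite !shuffle_nilr.
rewrite [RHS](shuffle_cons (h a) (h b) (map h u) (map h v)).
rewrite -[h b :: map h v]/(map h (b :: v)) -[h a :: map h u]/(map h (a :: u)).
by rewrite -IHu -IHv shuffle_cons map_cat -!map_comp.
Qed.

Lemma mem_shuffle_cons (T : eqType) (a b : T) u v s :
  (s \in shuffle (a :: u) (b :: v)) =
  if s is c :: s' then
    ((c == a) && (s' \in shuffle u (b :: v)))
      || ((c == b) && (s' \in shuffle (a :: u) v))
  else false.
Proof.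
rewrite shuffle_cons mem_cat; case: s => [|c s].
  by apply/negP => /orP[] /mapP[].
have E x (X : seq (seq T)) :
    (c :: s \in [seq x :: w | w <- X]) = (c == x) && (s \in X).
  apply/mapP/andP => [[w wX [-> ->]] | [/eqP-> sX]]; first by rewrite eqxx.
  by exists s.
by rewrite !E.
Qed.

Lemma perm_shuffle (T : eqType) (u v s : seq T) :
  s \in shuffle u v -> perm_eq s (u ++ v).
Proof.
move: u v s; apply: shuffle_ind => [v s|u s|a u b v IHu IHv [|c s]].
- by rewrite mem_seq1 => /eqP->.
- by rewrite shuffle_nilr mem_seq1 cats0 => /eqP->.
- by rewrite mem_shuffle_cons.
rewrite mem_shuffle_cons => /orP[] /andP[/eqP-> ].
  by move=> /IHu; rewrite cat_cons perm_cons.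
move=> /IHv s_perm.
by rewrite perm_sym (perm_catCA (a :: u) [:: b] v) perm_cons perm_sym.
Qed.

(** On disjoint alphabets a shuffle is characterised by its restrictions to them, so the two words
    can be recovered by filtering. *)
Lemma mem_shuffle_filter (T : eqType) (p : pred T) u v s :
    all p u -> all (predC p) v ->
  (s \in shuffle u v) = (filter p s == u) && (filter (predC p) s == v).
Proof.
have nilE r w : (filter (predC r) w == [::]) = all r w.
  by elim: w => //= x w IHw; case: (r x).
have nilE' r w : (filter r w == [::]) = all (predC r) w.
  by elim: w => //= x w IHw; case: (r x).
move: u v s; apply: shuffle_ind => [v s _ v_p|u s u_p _|a u b v IHu IHv [|c s]] //=.
- rewrite mem_seq1 nilE'; apply/eqP/andP => [->|[/all_filterP-> /eqP //]].
  by split=> //; apply/eqP/all_filterP.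
- rewrite shuffle_nilr mem_seq1 nilE; apply/eqP/andP => [->|[/eqP <- /all_filterP //]].
  by split=> //; apply/eqP/all_filterP.
- by rewrite -/(shuffle (a :: u) (b :: v)) mem_shuffle_cons.
rewrite -/(shuffle (a :: u) (b :: v)) mem_shuffle_cons.
move=> /andP[pa u_p] /andP[pb v_p].
rewrite IHu //= ?pb // IHv //= ?pa //.
case: (boolP (p c)) => pc /=; rewrite eqseq_cons.
  by rewrite (_ : c == b = false) ?orbF ?andbA //; apply: contraNF pb => /eqP <-.
by rewrite (_ : c == a = false) /= 1?andbCA //; apply: contraNF pc => /eqP ->.
Qed.

(* Inversion number and major index of the reversal of [s]. *)
Fixpoint inv_rev (s : seq nat) : nat :=
  if s is a :: s' then (count (ltn a) s' + inv_rev s')%N else 0.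

Fixpoint maj_rev (s : seq nat) : nat :=
  if s is a :: s' then ((a < head 0 s') * size s' + maj_rev s')%N else 0.

(** * q-binomial coefficients and generating functions over shuffles *)

Section QBinomial.

Variables (F : fieldType) (q : F).
Hypothesis qint_neq0 : forall n, (0 < n)%N -> qint q n != 0.

Definition qbin (m n : nat) : F := qfact q (m + n) / (qfact q m * qfact q n).

Lemma qfact0 : qfact q 0 = 1.
Proof. by rewrite /qfact big_geq. Qed.

Lemma qfactS n : qfact q n.+1 = qfact q n * qint q n.+1.
Proof. by rewrite /qfact big_nat_recr. Qed.

Lemma qfact_neq0 n : qfact q n != 0.
Proof.
by elim: n => [|n IHn]; rewrite ?qfact0 ?oner_neq0 // qfactS mulf_neq0 ?qint_neq0.
Qed.

Lemma qintD m n : qint q (m + n) = qint q n + q ^+ n * qint q m.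
Proof. by rewrite /qint mulrA -mulrDl addnC exprD; congr (_ / _); ring. Qed.

Lemma qbin0n n : qbin 0 n = 1.
Proof. by rewrite /qbin qfact0 mul1r divff ?qfact_neq0. Qed.

Lemma qbinn0 n : qbin n 0 = 1.
Proof. by rewrite /qbin qfact0 addn0 mulr1 divff ?qfact_neq0. Qed.

Lemma qbinC m n : qbin m n = qbin n m.
Proof. by rewrite /qbin addnC mulrC [qfact q n * _]mulrC mulrC. Qed.

(** [qintD] splits the q-integer of m + n + 2 into the two terms. The twin rule [qbin_pascal'] puts
    the power of q on the other term; the major index needs both. *)
Lemma qbin_pascal m n :
  qbin m.+1 n.+1 = q ^+ n.+1 * qbin m n.+1 + qbin m.+1 n.
Proof.
rewrite /qbin !addSn !addnS [qfact q (m + n).+2]qfactS.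
have -> : qint q (m + n).+2 = qint q n.+1 + q ^+ n.+1 * qint q m.+1.
  by rewrite -qintD addSn addnS.
rewrite [qfact q m.+1]qfactS [qfact q n.+1]qfactS.
have := qfact_neq0 m; have := qfact_neq0 n.
have := qint_neq0 (ltn0Sn m); have := qint_neq0 (ltn0Sn n).
move=> ? ? ? ?; field; exact/and4P.
Qed.

Lemma qbin_pascal' m n :
  qbin m.+1 n.+1 = qbin m n.+1 + q ^+ m.+1 * qbin m.+1 n.
Proof. by rewrite qbinC qbin_pascal addrC qbinC (qbinC n m.+1). Qed.

(** Condition on the first letter: [a] is below every letter of [b :: v] and gains its whole length,
    while [b] gains nothing from [a :: u]. The two cases are the two terms of the Pascal rule. *)
Lemma sum_shuffle_inv u v : allrel ltn u v ->
  \sum_(s <- shuffle u v) q ^+ inv_rev s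
  = q ^+ (inv_rev u + inv_rev v) * qbin (size u) (size v).
Proof.
move: u v; apply: shuffle_ind => [v _|u _|a u b v IHu IHv].
- by rewrite big_seq1 qbin0n mulr1.
- by rewrite shuffle_nilr big_seq1 qbinn0 mulr1 addn0.
move=> uv; have /[dup] uv' := uv; rewrite allrel_consl => /andP[a_bv u_bv].
have := u_bv; rewrite allrel_consr => /andP[u_b u_v].
have au_v : allrel ltn (a :: u) v by move: uv; rewrite allrel_consr => /andP[].
have a_b : (a < b)%N by case/andP: a_bv.
have lt_a : count (ltn a) (b :: v) = (size v).+1.
  by apply/eqP; rewrite -[_.+1]/(size (b :: v)) -all_count.
have lt_b : count (ltn b) (a :: u) = 0%N.
  apply/eqP; rewrite -leqn0 leqNgt -has_count -all_predC /= -leqNgt ltnW //=.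
  by apply: sub_all u_b => x /=; rewrite -leqNgt => /ltnW.
have sum_a : \sum_(s <- shuffle u (b :: v)) q ^+ inv_rev (a :: s)
    = q ^+ (count (ltn a) u + (size v).+1)
      * \sum_(s <- shuffle u (b :: v)) q ^+ inv_rev s.
  rewrite mulr_sumr; apply: eq_big_seq => s /perm_shuffle/seq.permP s_uv.
  by rewrite /= s_uv count_cat lt_a exprD.
have sum_b : \sum_(s <- shuffle (a :: u) v) q ^+ inv_rev (b :: s)
    = q ^+ count (ltn b) v * \sum_(s <- shuffle (a :: u) v) q ^+ inv_rev s.
  rewrite mulr_sumr; apply: eq_big_seq => s /perm_shuffle/seq.permP s_uv.
  by rewrite /= s_uv count_cat lt_b exprD.
rewrite shuffle_cons big_cat !big_map /= sum_a sum_b IHu // IHv //=.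
rewrite qbin_pascal !exprD; ring.
Qed.

(* Prepending [a] to the shuffles keeps track of their first letter, which is *)
(* what the recursion for the major index needs.                              *)
Lemma sum_shuffle_maj_cons u v : allrel ltn u v ->
  (forall a, all (ltn a) v ->
    \sum_(s <- shuffle u v) q ^+ maj_rev (a :: s)
    = q ^+ (maj_rev (a :: u) + maj_rev v + size v) * qbin (size u) (size v)) /\
  (forall b, all (gtn b) u ->
    \sum_(s <- shuffle u v) q ^+ maj_rev (b :: s)
    = q ^+ (maj_rev u + maj_rev (b :: v)) * qbin (size u) (size v)).
Proof.
move: u v; apply: shuffle_ind => [v _|u _|a u b v IHu IHv].
- split=> c c_v; rewrite big_seq1 qbin0n mulr1 //; congr (q ^+ _) => /=.
  by case: v c_v => //= b v /andP[-> _]; lia.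
- split=> c c_u; rewrite shuffle_nilr big_seq1 qbinn0 mulr1; congr (q ^+ _) => /=.
    by lia.
  by case: u c_u => //= a u /andP[ac _]; rewrite ltnNge ltnW //=; lia.
move=> uv; have := uv; rewrite allrel_consl => /andP[a_bv u_bv].
have := u_bv; rewrite allrel_consr => /andP[u_b u_v].
have au_v : allrel ltn (a :: u) v by move: uv; rewrite allrel_consr => /andP[].
have a_b : (a < b)%N by case/andP: a_bv.
have u_b' : all (gtn b) (a :: u) by rewrite /= a_b.
have [IHa _] := IHu u_bv; have [_ IHb] := IHv au_v.
have sz_a s : s \in shuffle u (b :: v) -> size s = (size u + (size v).+1)%N.
  by move=> /perm_shuffle/perm_size ->; rewrite size_cat.
have sz_b s : s \in shuffle (a :: u) v -> size s = ((size u).+1 + size v)%N.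
  by move=> /perm_shuffle/perm_size ->; rewrite size_cat.
(* A shuffle starts with [a] or [b], and [c] in front of it adds the full length exactly when [c] is
   below that letter. *)
have split_head c :
    \sum_(s <- shuffle (a :: u) (b :: v)) q ^+ maj_rev (c :: s)
    = q ^+ ((c < a) * (size u + size v).+2)%N
        * \sum_(s <- shuffle u (b :: v)) q ^+ maj_rev (a :: s)
      + q ^+ ((c < b) * (size u + size v).+2)%N
        * \sum_(s <- shuffle (a :: u) v) q ^+ maj_rev (b :: s).
  rewrite shuffle_cons big_cat !big_map !mulr_sumr.
  congr (_ + _); apply: eq_big_seq => s s_uv; rewrite -exprD /=.
    by rewrite (sz_a s s_uv) addnS.
  by rewrite (sz_b s s_uv) addSn.
have sum_a := IHa a a_bv; have sum_b := IHb b u_b'.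
have maj_cons c d w : maj_rev (c :: d :: w)
  = ((c < d) * (size w).+1 + maj_rev (d :: w))%N by [].
(* In each half one of the comparisons of [c] with [a] and [b] is forced; the other one decides
   which Pascal rule merges the two terms. *)
split=> [c c_bv|c c_au]; rewrite split_head sum_a sum_b maj_cons;
    move: (maj_rev (a :: u)) (maj_rev (b :: v)) => majau majbv /=.
  have -> /= : (c < b)%N by case/andP: c_bv.
  case: (c < a)%N; rewrite /= ?mul1n ?mul0n ?add0n ?expr0 ?mul1r.
    rewrite qbin_pascal !(exprD, exprS); ring.
  rewrite qbin_pascal' !(exprD, exprS); ring.
have -> /= : (c < a)%N = false by case/andP: c_au => /ltnW; rewrite leqNgt => /negPf.
case: (c < b)%N; rewrite /= ?mul1n ?mul0n ?add0n ?expr0 ?mul1r.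
  rewrite qbin_pascal' !(exprD, exprS); ring.
rewrite qbin_pascal !(exprD, exprS); ring.
Qed.

(** Splitting off the first letter leaves the two situations of [sum_shuffle_maj_cons]: [a] lies
    below all of [b :: v], and [b] above all of [a :: u]. *)
Lemma sum_shuffle_maj u v : allrel ltn u v ->
  \sum_(s <- shuffle u v) q ^+ maj_rev s
  = q ^+ (maj_rev u + maj_rev v) * qbin (size u) (size v).
Proof.
case: u v => [|a u] [|b v] uv; rewrite ?shuffle_nilr ?big_seq1.
- by rewrite qbin0n mulr1.
- by rewrite qbin0n mulr1.
- by rewrite qbinn0 mulr1 addn0.
have := uv; rewrite allrel_consl => /andP[a_bv u_bv].
have := uv; rewrite allrel_consr => /andP[au_b au_v].
rewrite shuffle_cons big_cat !big_map.
have u_b : all (gtn b) u by case/andP: au_b.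
have [-> // _] := sum_shuffle_maj_cons u_bv.
have [_ ->] := sum_shuffle_maj_cons au_v; last exact: au_b.
rewrite qbin_pascal !exprD.
by move: (maj_rev (a :: u)) (maj_rev (b :: v)) => majau majbv /=; ring.
Qed.

End QBinomial.

(** * Linear extensions of the forest of children *)

Definition merges (T : Type) (L1 L2 : seq (seq T)) : seq (seq T) :=
  [seq w | p <- [seq (x, y) | x <- L1, y <- L2], w <- shuffle p.1 p.2].

(* The linear extensions of the forest of [d]-children in the subtree [B]     *)
(* rooted at [u], as words listing ancestors first, that is, by decreasing    *)
(* label.                                                                     *)
Fixpoint linexts (d : bool) (u : vertex) (B : bintree) : seq (seq vertex) :=
  if B is Node l r then
    let Ll := linexts d (rcons u lft) l in
    let Lr := linexts d (rcons u rgt) r in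
    let L := if d == lft then merges Ll Lr else merges Lr Ll in
    if is_child d u then map (cons u) L else L
  else [:: [::]].

(** Naming the subtrees by reading order instead of by side lets one argument serve both
    directions. *)
Definition fst_subtree (d : bool) (l r : bintree) := if d then r else l.
Definition snd_subtree (d : bool) (l r : bintree) := if d then l else r.

Lemma readingE d u l r :
  reading d u (Node l r)
  = (reading d (rcons u d) (fst_subtree d l r)
       ++ reading d (rcons u (~~ d)) (snd_subtree d l r))
      ++ (if is_child d u then [:: u] else [::]).
Proof. by case: d. Qed.

Lemma linextsE d u l r :
  linexts d u (Node l r)
  = let L := merges (linexts d (rcons u d) (fst_subtree d l r))
                    (linexts d (rcons u (~~ d)) (snd_subtree d l r)) in
    if is_child d u then map (cons u) L else L.
Proof. by case: d. Qed.

Lemma bintree_dir_ind d (P : vertex -> bintree -> Prop) :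
    (forall u, P u Empty) ->
    (forall u l r, P (rcons u d) (fst_subtree d l r) ->
       P (rcons u (~~ d)) (snd_subtree d l r) -> P u (Node l r)) ->
  forall u B, P u B.
Proof.
move=> P0 PN u B; elim: B u => [|l IHl r IHr] u //.
by apply: PN; case: d.
Qed.

Lemma uniq_vertices B : uniq (vertices B).
Proof.
elim: B => [|l IHl r IHr] //=.
rewrite mem_cat cat_uniq !map_inj_uniq ?IHl ?IHr; try by move=> ? ? [].
rewrite andbT /=; apply/andP; split; first by apply/negP => /orP[] /mapP[].
by apply/hasPn => x /mapP[y _ ->]; apply/negP => /mapP[].
Qed.

Lemma perm_reading d u B :
  perm_eq (reading d u B) [seq x <- map (cat u) (vertices B) | is_child d x].
Proof.
elim: B u => [|l IHl r IHr] u //; rewrite [vertices _]/= map_cons cats0.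
rewrite [filter _ _]/= map_cat filter_cat -!map_comp.
have E b (X : seq vertex) :
    [seq (cat u \o cons b) i | i <- X] = map (cat (rcons u b)) X.
  by apply: eq_map => x /=; rewrite cat_rcons.
rewrite !E; set A := filter _ _; set C := filter _ _.
have lr : perm_eq (reading d (rcons u lft) l ++ reading d (rcons u rgt) r) (A ++ C).
  exact: perm_cat (IHl _) (IHr _).
have {}lr :
    perm_eq (if d == lft then reading d (rcons u lft) l ++ reading d (rcons u rgt) r
             else reading d (rcons u rgt) r ++ reading d (rcons u lft) l) (A ++ C).
  by case: (d == lft) => //; rewrite perm_catC.
rewrite /=; case: (is_child d u); rewrite ?cats0 //.
by rewrite perm_catC cat1s perm_cons.
Qed.

Lemma uniq_reading d u B : uniq (reading d u B).
Proof.
rewrite (perm_uniq (perm_reading d u B)) filter_uniq // map_inj_uniq ?uniq_vertices //.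
by move=> x y /eqP; rewrite eqseq_cat // eqxx => /eqP.
Qed.

Lemma prefix_reading d u B v : v \in reading d u B -> prefix u v.
Proof.
rewrite (perm_mem (perm_reading d u B)) mem_filter => /andP[_ /mapP[w _ ->]].
exact: prefix_prefix.
Qed.

Lemma prefix_rcons2 (T : eqType) (u v : seq T) a b :
  prefix (rcons u a) v -> prefix (rcons u b) v -> a = b.
Proof.
move=> /prefixP[s ->]; rewrite !cat_rcons => /prefixP[t].
by rewrite cat_rcons => /eqP; rewrite eqseq_cat // eqxx => /eqP[].
Qed.

Lemma prefix_rconsN (T : eqType) (u v : seq T) a :
  prefix (rcons u a) v -> ~~ prefix v u.
Proof.
move=> /size_prefix; rewrite size_rcons => uv; apply/negP => /size_prefix.
by rewrite leqNgt uv.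
Qed.

Lemma mem_merges (T : eqType) (p : pred T) (L1 L2 : seq (seq T)) w :
    {in L1, forall x, all p x} -> {in L2, forall x, all (predC p) x} ->
  (w \in merges L1 L2) = (filter p w \in L1) && (filter (predC p) w \in L2).
Proof.
move=> p1 p2; apply/allpairsPdep/andP => [[[x y] [z [+ /= + ->]]]|[w1 w2]].
  case/allpairsP=> -[x' y'] /= [x1 y2 [-> ->]].
  by rewrite (mem_shuffle_filter (p := p)) ?p1 ?p2 // => /andP[/eqP-> /eqP->].
exists (filter p w, filter (predC p) w), w; split=> //.
  by apply/allpairsP; exists (filter p w, filter (predC p) w).
by rewrite (mem_shuffle_filter (p := p)) ?p1 ?p2 ?eqxx.
Qed.

Lemma uniq_shuffle (T : eqType) (p : pred T) (u v : seq T) :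
  all p u -> all (predC p) v -> uniq (shuffle u v).
Proof.
move: u v; apply: shuffle_ind => [v|u|a u b v IHu IHv]; rewrite ?shuffle_nilr //.
move=> /[dup] pau /= /andP[pa pu] /[dup] pbv /= /andP[pb pv].
rewrite -/(shuffle (a :: u) (b :: v)) shuffle_cons cat_uniq.
rewrite !map_inj_uniq ?IHu ?IHv //; try by move=> ? ? [].
rewrite andbT /=; apply/hasPn => x /mapP[y _ ->]; apply/negP => /mapP[z _ [ba _]].
by move: pb; rewrite /= ba pa.
Qed.

Lemma uniq_merges (T : eqType) (p : pred T) (L1 L2 : seq (seq T)) :
    {in L1, forall x, all p x} -> {in L2, forall x, all (predC p) x} ->
  uniq L1 -> uniq L2 -> uniq (merges L1 L2).
Proof.
move=> p1 p2 U1 U2; apply: allpairs_uniq_dep => [|x|].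
- by apply: allpairs_uniq => // -[? ?] [? ?].
- case/allpairsP=> -[y z] /= [y1 z2 ->]; apply: (@uniq_shuffle _ p); [exact: p1|exact: p2].
move=> _ _ /allpairsPdep[[x1 y1] [w1 [+ + ->]]] /allpairsPdep[[x2 y2] [w2 [+ + ->]]] /=.
move=> /allpairsP[[x1' y1'] [/= x11 y12 [-> ->]]] w1_sh.
move=> /allpairsP[[x2' y2'] [/= x21 y22 [-> ->]]] w2_sh w12.
move: w1_sh w2_sh; rewrite !(mem_shuffle_filter (p := p)) ?p1 ?p2 //.
by rewrite w12 => /andP[/eqP<- /eqP<-] /andP[/eqP<- /eqP<-].
Qed.

(** When the relation is automatic across the two classes, any violating pair survives inside one of
    the two restrictions. *)
Lemma pairwise_filterC (T : eqType) (e : rel T) (p : pred T) (s : seq T) :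
    {in s &, forall x y, p x != p y -> e x y} ->
  pairwise e s = pairwise e (filter p s) && pairwise e (filter (predC p) s).
Proof.
move=> e_p; apply/idP/andP => [s_e|[]]; first by rewrite !pairwise_filter.
elim: s e_p => //= x s IHs e_p; have {}IHs := IHs _.
have [e_s|] := boolP (all (e x) s).
  move=> es1 es2; rewrite IHs //.
    by move=> y z ys zs; apply: e_p; rewrite inE ?ys ?zs orbT.
    by move: es1; case: (p x) => //= /andP[].
  by move: es2; case: (p x) => //= /andP[].
case/allPn => y ys /negP xy px px'; case: xy.
have [pxy|] := eqVneq (p x) (p y); last by apply: e_p; rewrite inE ?eqxx ?ys ?orbT.
case Ep: (p x) px px' pxy => /=.
  by move=> /andP[/allP xs _] _ py; apply: xs; rewrite mem_filter -py.
by move=> _ /andP[/allP xs _] py; apply: xs; rewrite mem_filter /= -py.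
Qed.

Definition not_descendant (u v : vertex) : bool := ~~ proper_ancestor v u.

(** Vertices of different branches are incomparable, so the order condition splits into one
    condition per branch, and shuffles realise every way of interleaving them. A counted root is
    above all the rest and must come first. *)
Lemma mem_linexts d u B w :
  (w \in linexts d u B)
  = perm_eq w (reading d u B) && pairwise not_descendant w.
Proof.
move: u B w; apply: (bintree_dir_ind (d := d)) => [u w|u l r].
  rewrite mem_seq1; case: w => // x w.
  by apply/esym/negP => /andP[/perm_size].
rewrite readingE linextsE /=.
set R1 := reading _ _ _; set R2 := reading _ _ _; set L1 := linexts _ _ _.
set L2 := linexts _ _ _ => IH1 IH2.
pose p := prefix (rcons u d).
have pR1 : all p R1 by apply/allP => x /prefix_reading.
have pR2 : all (predC p) R2.
  by apply/allP => x /prefix_reading ux; apply/negP => /(prefix_rcons2 ux); case d.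
have memL x : x \in merges L1 L2 = perm_eq x (R1 ++ R2) && pairwise not_descendant x.
  rewrite (mem_merges (p := p)).
  - rewrite IH1 IH2 andbACA.
    have filterR : filter p (R1 ++ R2) = R1 /\ filter (predC p) (R1 ++ R2) = R2.
      split; rewrite filter_cat.
        have /all_filterP -> := pR1; rewrite -[RHS]cats0; congr cat.
        by apply/eqP; rewrite -size_eq0 size_filter -leqn0 leqNgt -has_count -all_predC.
      have /all_filterP -> := pR2; rewrite -[RHS]cat0s; congr cat.
      apply/eqP; rewrite -size_eq0 size_filter -leqn0 leqNgt -has_count -all_predC.
      by apply: sub_all pR1 => y py /=; rewrite negbK.
    apply/andP/andP => -[x_perm x_pw].
      have {}x_perm : perm_eq x (R1 ++ R2).
        by case/andP: x_perm => ? ?; rewrite -(perm_filterC p x) perm_cat.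
      split=> //; rewrite (pairwise_filterC (p := p)) // => a b.
      rewrite !(perm_mem x_perm) !mem_cat => aR bR; apply: contraNN => /andP[ba _].
      case/orP: bR => bR.
        by have pb := allP pR1 b bR; rewrite pb /p (prefix_trans pb ba).
      have ub : prefix (rcons u (~~ d)) b := prefix_reading bR.
      have /negPf -> : ~~ p b := allP pR2 b bR.
      apply/eqP/negP => pa; have := prefix_rcons2 pa (prefix_trans ub ba).
      by case d.
    have [f1 f2] := filterR; rewrite !pairwise_filter //; split=> //.
    by apply/andP; split; [rewrite -f1|rewrite -f2]; exact: perm_filter.
  - by move=> y; rewrite IH1 => /andP[/perm_all-> _].
  - by move=> y; rewrite IH2 => /andP[/perm_all-> _].
have uR x : x \in R1 ++ R2 -> prefix u x && ~~ prefix x u.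
  rewrite mem_cat => /orP[] /prefix_reading ux;
  by rewrite (prefix_rconsN ux) (prefix_trans (prefix_rcons _ _) ux).
case: ifP => _ w; last by rewrite cats0 memL.
have perm_u x y : perm_eq (u :: x) (y ++ [:: u]) = perm_eq x y.
  by rewrite (permPr (permEl (perm_catC y [:: u]))) perm_cons.
apply/mapP/andP => [[x + ->]|[w_perm w_pw]].
  rewrite memL perm_u => /andP[x_perm x_pw]; split=> //=; rewrite x_pw andbT.
  apply/allP => y; rewrite (perm_mem x_perm) => /uR /andP[_ yu].
  by rewrite /not_descendant /proper_ancestor (negPf yu).
case: w w_perm w_pw => [/perm_size|c w w_perm /=]; first by rewrite size_cat addn1.
case/andP=> c_w w_pw.
(* Otherwise [u] would occur after the first letter [c], which is a descendant of [u]. *)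
have cu : c = u.
  have : c \in (R1 ++ R2) ++ [:: u] by rewrite -(perm_mem w_perm) mem_head.
  rewrite mem_cat mem_seq1 => /orP[/uR /andP[uc cu]|/eqP //].
  have : u \in c :: w by rewrite (perm_mem w_perm) mem_cat mem_head orbT.
  rewrite inE => /orP[/eqP //|/(allP c_w)].
  by rewrite /not_descendant /proper_ancestor uc /= negbK => /eqP.
by subst c; exists w; rewrite // memL w_pw andbT -perm_u.
Qed.

Lemma uniq_linexts d u B : uniq (linexts d u B).
Proof.
move: u B; apply: (bintree_dir_ind (d := d)) => // u l r U1 U2.
rewrite linextsE /=; set L := merges _ _; suff UL : uniq L.
  by case: ifP => // _; rewrite map_inj_uniq // => ? ? [].
apply: (uniq_merges (p := prefix (rcons u d))) => // w; rewrite mem_linexts.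
  by case/andP=> /perm_all-> _; apply/allP => x /prefix_reading.
case/andP=> /perm_all-> _; apply/allP => x /prefix_reading ux.
by apply/negP => /(prefix_rcons2 ux); case d.
Qed.

(** * The hook formula for linear extensions *)

Section SumLinexts.

Variables (F : fieldType) (q : F) (st : seq nat -> nat).
Hypothesis qint_neq0 : forall n, (0 < n)%N -> qint q n != 0.
Hypothesis st0 : st [::] = 0%N.
Hypothesis st_shuffle : forall u v, allrel ltn u v ->
  \sum_(s <- shuffle u v) q ^+ st s
  = q ^+ (st u + st v) * qbin q (size u) (size v).
Hypothesis st_cons : forall a s, all (gtn a) s -> st (a :: s) = st s.

(** Since [h] increases along the reading, the two branches have separated alphabets, so
    [st_shuffle] applies, and the root has the largest letter, so [st_cons] applies. *)
Lemma sum_linexts (h : vertex -> nat) d u B :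
    pairwise (relpre h ltn) (reading d u B) ->
  \sum_(w <- linexts d u B) q ^+ st (map h w)
  = qfact q (size (reading d u B))
    / \prod_(v <- reading d u B) qint q (count (prefix v) (reading d u B)).
Proof.
move: u B; apply: (bintree_dir_ind (d := d)) => [u _|u l r].
  by rewrite /= big_seq1 big_nil st0 expr0 qfact0 divr1.
rewrite readingE linextsE.
set R1 := reading _ _ _; set R2 := reading _ _ _; set L1 := linexts _ _ _.
set L2 := linexts _ _ _ => IH1 IH2.
rewrite !pairwise_cat => /and3P[hu /and3P[h12 h1 h2] _].
have disj a v x : prefix (rcons u a) v -> prefix (rcons u (~~ a)) x -> ~~ prefix v x.
  move=> uv ux; apply/negP => /(prefix_trans uv) /(prefix_rcons2 ux).
  by case a.
have countR s a : {in s, forall x, prefix (rcons u (~~ a)) x} ->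
    forall v, prefix (rcons u a) v -> count (prefix v) s = 0%N.
  move=> us v uv; apply/eqP; rewrite -leqn0 leqNgt -has_count; apply/hasPn => x xs.
  exact: disj uv (us x xs).
(* Here [s] is empty or the single root; the hook of a vertex in one branch sees neither the other
   branch nor the root. *)
have prodR s : {in s, forall x, ~~ prefix (rcons u d) x && ~~ prefix (rcons u (~~ d)) x} ->
  \prod_(v <- R1 ++ R2) qint q (count (prefix v) ((R1 ++ R2) ++ s))
  = \prod_(v <- R1) qint q (count (prefix v) R1)
    * \prod_(v <- R2) qint q (count (prefix v) R2).
  move=> us; rewrite big_cat; congr (_ * _); apply: eq_big_seq => v;
    move=> /prefix_reading uv; rewrite !count_cat.
    rewrite (countR R2 d _ v uv) => [|x]; last exact: prefix_reading.
    suff -> : count (prefix v) s = 0%N by rewrite !addn0.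
    apply/eqP; rewrite -leqn0 leqNgt -has_count; apply/hasPn => x /us /andP[ux _].
    by apply: contraNN ux; exact: prefix_trans.
  rewrite (countR R1 (~~ d) _ v uv) => [|x]; last first.
    by rewrite negbK; exact: prefix_reading.
  suff -> : count (prefix v) s = 0%N by rewrite addn0.
  apply/eqP; rewrite -leqn0 leqNgt -has_count; apply/hasPn => x /us /andP[_ ux].
  by apply: contraNN ux; exact: prefix_trans.
have sumL : \sum_(w <- merges L1 L2) q ^+ st (map h w)
    = qfact q (size R1 + size R2)
      / (\prod_(v <- R1) qint q (count (prefix v) R1)
         * \prod_(v <- R2) qint q (count (prefix v) R2)).
  rewrite big_allpairs_dep big_allpairs /=.
  have -> : \sum_(x <- L1) \sum_(y <- L2) \sum_(w <- shuffle x y) q ^+ st (map h w)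
      = (\sum_(x <- L1) q ^+ st (map h x)) * (\sum_(y <- L2) q ^+ st (map h y))
        * qbin q (size R1) (size R2).
    rewrite big_distrlr /= mulr_suml; apply: eq_big_seq => x.
    rewrite mulr_suml mem_linexts => /andP[xR1 _].
    apply: eq_big_seq => y; rewrite mem_linexts => /andP[yR2 _].
    rewrite -(big_map (map h) xpredT (fun s => q ^+ st s)) map_shuffle.
    rewrite st_shuffle ?exprD ?size_map ?(perm_size xR1) ?(perm_size yR2) //.
    rewrite allrel_mapl allrel_mapr (eq_allrel_mem2 _ (perm_mem xR1) (perm_mem yR2)).
    exact: h12.
  rewrite IH1 // IH2 // /qbin.
  have f1 := qfact_neq0 qint_neq0 (size R1).
  have f2 := qfact_neq0 qint_neq0 (size R2).
  rewrite -/R1 -/R2 !invfM.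
  set p1 := (\prod_(v <- R1) _)^-1; set p2 := (\prod_(v <- R2) _)^-1.
  by field; apply/andP.
move: hu; case: ifP => _ hu /=; last first.
  by rewrite cats0 size_cat sumL; have := prodR [::]; rewrite cats0 => ->.
rewrite big_map /=.
have -> : \sum_(w <- merges L1 L2) q ^+ st (h u :: map h w)
    = \sum_(w <- merges L1 L2) q ^+ st (map h w).
  apply: eq_big_seq => w /allpairsPdep[[x y] [z [+ /= zxy ->]]].
  case/allpairsP => -[x' y'] /= [xL yL [? ?]]; subst x' y'.
  rewrite st_cons // all_map; move: hu; rewrite allrel1r => /=.
  rewrite (eq_all (a2 := preim h (gtn (h u)))) // => hu.
  move: xL yL; rewrite !mem_linexts => /andP[xR1 _] /andP[yR2 _].
  by rewrite (perm_all _ (perm_shuffle zxy)) (perm_all _ (perm_cat xR1 yR2)).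
rewrite sumL big_cat big_seq1 prodR /= => [|x]; last first.
  by rewrite mem_seq1 => /eqP->; rewrite !(prefix_rconsN (prefix_refl _)).
(* The hook of the root is the whole subtree, so its q-integer cancels the last factor of the larger
   q-factorial. *)
have -> : count (prefix u) ((R1 ++ R2) ++ [:: u]) = (size R1 + size R2).+1.
  rewrite -size_cat -addn1 -(size_cat _ [:: u]); apply/eqP; rewrite -all_count.
  rewrite !all_cat /= prefix_refl !andbT; apply/andP.
  by split; apply/allP => x /prefix_reading; apply: prefix_trans; exact: prefix_rcons.
by rewrite !size_cat addn1 qfactS -mulf_div divff ?mulr1 ?qint_neq0.
Qed.

End SumLinexts.

(** * From a permutation to the word of its inverse *)

Section Statistics.

Local Open Scope nat_scope.

(** Summing over pairs of letters rather than of positions makes this comparable with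
    [inv_rev_map]. *)
Lemma inversions_map (T : eqType) (g : T -> nat) (s : seq T) : uniq s ->
  inversions (map g s)
  = \sum_(x <- s) \sum_(y <- s) ((index x s < index y s) && (g y < g x)).
Proof.
move=> s_uniq; rewrite /inversions -sum1_card.
transitivity (\sum_(i < size (map g s)) \sum_(j < size (map g s))
   ((i < j) && (nth 0 (map g s) j < nth 0 (map g s) i))).
  rewrite pair_big /= big_mkcond; apply: eq_bigr => p _.
  by rewrite inE; case: (_ && _).
case: s s_uniq => [|x0 s'] s_uniq; first by rewrite big_ord0 big_nil.
move: (x0 :: s') s_uniq => s s_uniq.
rewrite (big_nth x0) big_mkord size_map; apply: eq_bigr => i _.
rewrite (big_nth x0) big_mkord; apply: eq_bigr => j _.
by rewrite !index_uniq // !(nth_map x0).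
Qed.

Lemma inv_rev_map (T : eqType) (h : T -> nat) (w : seq T) : uniq w ->
  inv_rev (map h w)
  = \sum_(x <- w) \sum_(y <- w) ((index x w < index y w) && (h x < h y)).
Proof.
elim: w => [|a w IHw] /=; first by rewrite big_nil.
case/andP=> aw w_uniq; rewrite IHw // big_cons /= eqxx; congr (_ + _).
  rewrite big_cons eqxx ltnn /= add0n count_map -sum1_count big_mkcond /=.
  apply: eq_big_seq => y yw; have /negPf-> : a != y by apply: contraNneq aw => ->.
  by case: (h a < h y).
apply: eq_big_seq => x xw; rewrite big_cons eqxx ltn0 /= add0n.
have /negPf-> : a != x by apply: contraNneq aw => ->.
apply: eq_big_seq => y yw.
by have /negPf-> : a != y by apply: contraNneq aw => ->.
Qed.

(** A first letter smaller than its successor becomes, after reversal, a descent at the last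
    possible place, whose index is the length of the rest. *)
Lemma maj_revE (s : seq nat) :
  \sum_(1 <= i < size s | is_descent (rev s) i) i = maj_rev s.
Proof.
elim: s => [|a s IHs]; first by rewrite big_geq.
case: s IHs => [|b s] IHs; first by rewrite big_geq.
rewrite [RHS]/= -/(maj_rev (b :: s)) -IHs.
rewrite [LHS]big_mkcond /= big_nat_recr //= addnC; congr (_ + _).
  rewrite /is_descent (rev_cons a) !nth_rcons size_rev /= ltnn eqxx ltnSn.
  by rewrite nth_rev //= subnn mulnbl.
rewrite [RHS]big_mkcond /=; apply: eq_big_nat => i /andP[i0 i_s].
rewrite /is_descent (rev_cons a) !nth_rcons size_rev /= i_s.
by rewrite (leq_ltn_trans (leq_pred i) i_s).
Qed.

Variables (T : eqType) (g : T -> nat) (s w : seq T).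
Hypothesis s_uniq : uniq s.
Hypothesis w_perm : perm_eq w s.
Hypothesis g_w : map g (rev w) = iota 1 (size s).

Let w_uniq : uniq w. Proof. by rewrite (perm_uniq w_perm). Qed.

Let uniq_map_g : uniq (map g s).
Proof.
rewrite -(perm_uniq (perm_map g w_perm)) -rev_uniq -map_rev g_w.
exact: iota_uniq.
Qed.

(** Labels decrease along [w] and [index] counts from 0, so the first letter has label [size s]. *)
Let g_index x : x \in w -> g x = size s - index x w.
Proof.
move=> xw; have iw := xw; rewrite -index_mem in iw.
have e : nth 0 (map g (rev w)) (size w - (index x w).+1) = g x.
  rewrite (nth_map x) ?size_rev ?nth_rev; try lia.
  by rewrite subnSK // subKn ?nth_index // ltnW.
by rewrite -e g_w nth_iota -(perm_size w_perm); lia.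
Qed.

(** Both sides count the same pairs: by [g_index], a larger label means an earlier place in [w], so
    the two conditions merely trade roles. *)
Lemma inversions_inv_rev : inversions (map g s) = inv_rev (map (index^~ s) w).
Proof.
rewrite inversions_map // inv_rev_map // -(perm_big _ w_perm) /=.
apply: eq_big_seq => x xw; rewrite -(perm_big _ w_perm); apply: eq_big_seq => y yw.
rewrite !g_index // andbC; congr (nat_of_bool (_ && _)).
have := xw; have := yw; rewrite -!index_mem (perm_size w_perm); lia.
Qed.

(** Entry k of the inverse is the place in [s] of the letter labelled k, and these letters are
    [rev w] in order. The shift by one does not affect descents. *)
Lemma imaj_maj_rev : imaj (map g s) = maj_rev (map (index^~ s) w).
Proof.
rewrite -maj_revE /imaj.
have -> : inverse (map g s) = map succn (rev (map (index^~ s) w)).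
  rewrite /inverse size_map -g_w -map_comp -map_rev -map_comp.
  apply/eq_in_map => x; rewrite mem_rev (perm_mem w_perm) => xs /=.
  congr _.+1; have i_s : index x s < size s by rewrite index_mem.
  rewrite -[in LHS](nth_index x xs) -(nth_map x 0 g i_s) index_uniq // ?size_map //.
rewrite !size_map (perm_size w_perm) big_nat_cond [RHS]big_nat_cond.
apply: eq_bigl => i; case: (boolP (1 <= i < size s)) => //= /andP[i0 i_s].
have sz : size (rev (map (index^~ s) w)) = size s.
  by rewrite size_rev size_map (perm_size w_perm).
rewrite /is_descent !(nth_map 0) ?sz //; lia.
Qed.

End Statistics.

Lemma index_rev (T : eqType) (s : seq T) x : uniq s -> x \in s ->
  index x (rev s) = (size s - (index x s).+1)%N.
Proof.
move=> s_uniq xs; have i_s : (index x s < size s)%N by rewrite index_mem.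
have e : nth x (rev s) (size s - (index x s).+1) = x.
  by rewrite nth_rev ?subnSK ?subKn ?nth_index //; lia.
by rewrite -[x in LHS]e index_uniq ?rev_uniq // size_rev; lia.
Qed.

(** * Decreasing labellings as linear extensions *)

Section Labellings.

Variables (d : bool) (B : bintree).

Let R := reading d [::] B.

Lemma reading_children : perm_eq (map (@ssval _ _) (enum (children d B))) R.
Proof.
apply: uniq_perm.
- rewrite map_inj_uniq ?enum_uniq //; exact: val_inj.
- exact: uniq_reading.
move=> x; rewrite (perm_mem (perm_reading d [::] B)) map_id.
apply/mapP/idP => [[u _ ->]|x_in]; first exact: ssvalP.
by exists (SeqSub x_in); rewrite // mem_enum.
Qed.

Lemma size_reading : size R = #|children d B|.
Proof. by rewrite -(perm_size reading_children) size_map -cardE. Qed.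

Lemma ssval_reading (u : children d B) : ssval u \in R.
Proof.
by rewrite -(perm_mem reading_children); apply/mapP; exists u; rewrite ?mem_enum.
Qed.

Lemma readingP x : reflect (exists u : children d B, x = ssval u) (x \in R).
Proof.
rewrite -(perm_mem reading_children).
by apply: (iffP mapP) => [[u _]|[u]] ->; exists u; rewrite ?mem_enum.
Qed.

Lemma label_ssval (f : labelling d B) (u : children d B) :
  label f (ssval u) = (f u).+1.
Proof. by rewrite /label -[ssval u]/(val u) valK. Qed.

Lemma count_prefix_reading (u : children d B) : count (prefix (ssval u)) R = E u.
Proof.
rewrite -(seq.permP reading_children) count_map enumT /E cardE /enum_mem size_filter.
by apply: eq_count => v /=; rewrite inE.
Qed.

Lemma prod_children (F : fieldType) (q : F) :
  \prod_(U : children d B) qint q (E U) = \prod_(v <- R) qint q (count (prefix v) R).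
Proof.
rewrite -(perm_big _ reading_children) big_map big_enum /=.
by apply: eq_bigr => u _; rewrite count_prefix_reading.
Qed.

(** The last letter of [w] gets the smallest label. The default [enum_rank u] only provides an
    ordinal of the right type; it is never reached when [w] is a permutation of [R]. *)
Definition word_labelling (w : seq vertex) : labelling d B :=
  [ffun u => insubd (enum_rank u) (index (ssval u) (rev w))].

Lemma label_word_labelling w x : perm_eq w R -> x \in R ->
  label (word_labelling w) x = (index x (rev w)).+1.
Proof.
move=> w_perm /readingP[u ->]; rewrite label_ssval ffunE val_insubd.
have -> // : (index (ssval u) (rev w) < #|children d B|)%N.
rewrite -size_reading -(perm_size w_perm) -(size_rev w) index_mem mem_rev.
by rewrite (perm_mem w_perm) ssval_reading.
Qed.

Lemma map_label_word_labelling w : perm_eq w R ->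
  map (label (word_labelling w)) (rev w) = iota 1 (size R).
Proof.
move=> w_perm; have w_uniq : uniq (rev w).
  by rewrite rev_uniq (perm_uniq w_perm) uniq_reading.
apply: (@eq_from_nth _ 0%N) => [|i].
  by rewrite size_map size_rev size_iota (perm_size w_perm).
rewrite size_map => i_w; have iR : (i < size R)%N.
  by rewrite -(perm_size w_perm) -size_rev.
rewrite (nth_map [::]) // nth_iota // label_word_labelling //.
  by rewrite index_uniq.
by rewrite -(perm_mem w_perm) -mem_rev mem_nth.
Qed.

(** The labelling determines the word: [rev w] is the only list in [R] whose labels read 1, 2, and
    so on. *)
Lemma word_labelling_inj : {in linexts d [::] B &, injective word_labelling}.
Proof.
move=> w1 w2; rewrite !mem_linexts => /andP[p1 _] /andP[p2 _] e12.
apply: (can_inj revK).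
have lab_inj : {in R &, injective (label (word_labelling w1))}.
  move=> x y xR yR; rewrite !label_word_labelling // => -[xy].
  by apply: (@index_inj _ [::] (rev w1)) xy; rewrite mem_rev (perm_mem p1).
apply: (inj_in_map lab_inj).
- by apply/allP => x; rewrite mem_rev (perm_mem p1).
- by apply/allP => x; rewrite mem_rev (perm_mem p2).
by rewrite {2}e12 !map_label_word_labelling.
Qed.

Lemma decreasing_word_labelling w : w \in linexts d [::] B ->
  decreasing_bijection (word_labelling w).
Proof.
rewrite mem_linexts => /andP[w_perm w_pw].
have w_uniq : uniq w by rewrite (perm_uniq w_perm) uniq_reading.
have val_wl u : word_labelling w u = index (ssval u) (rev w) :> nat.
  by apply: succn_inj; rewrite -label_ssval label_word_labelling ?ssval_reading.
have wl_inj : injective (word_labelling w).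
  move=> u v /(congr1 val); rewrite /= !val_wl => uv; apply: val_inj.
  by apply: (@index_inj _ [::] (rev w)) uv; rewrite mem_rev (perm_mem w_perm) ssval_reading.
apply/and3P; split; first exact/injectiveP.
  have [g _ gK] := inj_card_bij wl_inj (eq_leq (card_ord _)).
  by apply/forallP => i; apply/existsP; exists (g i); rewrite gK.
apply/forallP => u; apply/forallP => v; apply/implyP => uv.
have mem_w (x : children d B) : ssval x \in w by rewrite (perm_mem w_perm) ssval_reading.
rewrite !val_wl !index_rev //.
have iu : (index (ssval u) w < size w)%N by rewrite index_mem.
have iv : (index (ssval v) w < size w)%N by rewrite index_mem.
suff ui : (index (ssval u) w < index (ssval v) w)%N.
  by apply: ltn_sub2l; first exact: leq_ltn_trans ui iv.
rewrite ltnNge; apply/negP; rewrite leq_eqVlt => /orP[/eqP vu|vu].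
  by case/andP: uv => _ /eqP; apply; apply: (@index_inj _ [::] w) (esym vu).
have := elimT (pairwiseP [::]) w_pw _ _ iv iu vu.
by rewrite !nth_index // /not_descendant uv.
Qed.

(** The witness lists the vertices by decreasing label, through the inverse [g] of the labelling. *)
Lemma word_of_labelling f : decreasing_bijection f ->
  exists2 w, w \in linexts d [::] B & f = word_labelling w.
Proof.
case/and3P=> /injectiveP f_inj _ /forallP f_decr.
have [g fK gK] := inj_card_bij f_inj (eq_leq (card_ord _)).
pose h i := ssval (g i).
have h_inj : injective h by move=> i j ij; apply: (can_inj gK); apply: val_inj.
pose v := map h (enum 'I_#|children d B|).
have v_uniq : uniq v by rewrite map_inj_uniq ?enum_uniq.
have v_perm : perm_eq v R.
  apply: uniq_perm => //; first exact: uniq_reading.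
  move=> x; apply/mapP/idP => [[i _ ->]|/readingP[u ->]]; first exact: ssval_reading.
  by exists (f u); rewrite ?mem_enum /h ?fK.
have index_v u : index (ssval u) v = f u.
  by rewrite -[u in LHS]fK -[ssval _]/(h (f u)) index_map // index_enum_ord.
exists (rev v); last first.
  apply/ffunP => u; rewrite ffunE revK; apply: val_inj.
  by rewrite val_insubd index_v ltn_ord.
rewrite mem_linexts perm_rev v_perm /=.
apply/(pairwiseP [::]) => i j.
rewrite !inE !size_rev => i_n j_n ij; rewrite !nth_rev //.
have ltv k : (size v - k.+1 < size v)%N.
  by rewrite ltn_subrL (leq_ltn_trans (leq0n i) i_n).
have nthP k : exists2 u, nth [::] v (size v - k.+1) = ssval u
    & f u = (size v - k.+1)%N :> nat.
  have /readingP[u u_nth] : nth [::] v (size v - k.+1) \in R.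
    by rewrite -(perm_mem v_perm) mem_nth.
  by exists u; rewrite // -index_v -u_nth index_uniq.
have [x -> fx] := nthP i; have [y -> fy] := nthP j.
(* If the later letter [y] were an ancestor of [x], its label would be larger, but labels decrease
   along the word. *)
apply/negP => yx; have /forallP/(_ x)/implyP/(_ yx) := f_decr y.
by rewrite fx fy ltnNge leq_sub2l // ltnS ltnW.
Qed.

(** Change variables from labellings to words, then apply [sum_linexts] with [h] the position in the
    reading, which is increasing along [R] by construction. *)
Lemma sum_labellings (F : fieldType) (q : F) (S : seq nat -> nat) :
    (forall n, (0 < n)%N -> qint q n != 0) ->
    S = inversions \/ S = imaj ->
  \sum_(f : labelling d B | decreasing_bijection f) q ^+ S (map (label f) R)
  = qfact q #|children d B| / \prod_(U : children d B) qint q (E U).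
Proof.
move=> qint_neq0 S_stat; rewrite prod_children -size_reading.
have R_uniq : uniq R := uniq_reading d [::] B.
have -> : \sum_(f : labelling d B | decreasing_bijection f) q ^+ S (map (label f) R)
    = \sum_(w <- linexts d [::] B) q ^+ S (map (label (word_labelling w)) R).
  rewrite -big_enum /= -(big_map word_labelling xpredT (fun f => q ^+ S (map (label f) R))).
  apply: perm_big; apply: uniq_perm; first exact: enum_uniq.
    by rewrite map_inj_in_uniq ?uniq_linexts //; exact: word_labelling_inj.
  move=> f; rewrite mem_enum; apply/idP/mapP => [/word_of_labelling[w]|[w w_ext ->]].
    by exists w.
  exact: decreasing_word_labelling.
have index_sorted : pairwise (relpre (index^~ R) ltn) R.
  apply/(pairwiseP [::]) => i j; rewrite !inE => i_n j_n ij.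
  by rewrite /= !index_uniq.
case: S_stat => ->.
- rewrite -(@sum_linexts _ _ inv_rev _ _ _ _ (index^~ R)) //.
  + apply: eq_big_seq => w; rewrite mem_linexts => /andP[w_perm _].
    by rewrite (inversions_inv_rev R_uniq w_perm) // map_label_word_labelling.
  + exact: sum_shuffle_inv.
  move=> a s /= a_s; rewrite (_ : count _ _ = 0%N) //.
  apply/eqP; rewrite -leqn0 leqNgt -has_count -all_predC.
  by apply: sub_all a_s => x /=; rewrite -leqNgt => /ltnW.
- rewrite -(@sum_linexts _ _ maj_rev _ _ _ _ (index^~ R)) //.
  + apply: eq_big_seq => w; rewrite mem_linexts => /andP[w_perm _].
    by rewrite (imaj_maj_rev R_uniq w_perm) // map_label_word_labelling.
  + exact: sum_shuffle_maj.
  by move=> a [|b s] //= /andP[ab _]; rewrite ltnNge ltnW.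
Qed.

End Labellings.

(** * Specialisation to the formal variables *)

Lemma qint_mpolyX_neq0 (i : 'I_2) n : (0 < n)%N ->
  qint (tofrac ('X_i : {mpoly int[2]}) : ratfun) n != 0.
Proof.
move=> n_gt0.
have sub_neq0 m : (0 < m)%N -> 1 - (tofrac ('X_i : {mpoly int[2]}) : ratfun) ^+ m != 0.
  move=> m_gt0; rewrite subr_eq0 eq_sym -rmorphXn -(rmorph1 (@tofrac _)).
  (* Evaluation at 0 separates a positive power of the variable from 1. *)
  rewrite tofrac_eq; apply/eqP => /(congr1 (meval (fun _ => 0))).
  by rewrite rmorphXn /= mevalXU meval1 expr0n eqn0Ngt m_gt0.
by rewrite /qint mulf_neq0 ?invr_neq0 ?sub_neq0 // -[X in 1 - X]expr1 sub_neq0.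
Qed.

Theorem mainTheorem8 (B : bintree) (S : seq nat -> nat)
    (B_nonempty : B <> Empty) (S_stat : S = inversions \/ S = imaj) :
  \sum_(T in NAT B) qL ^+ S (sigmaL T) * qR ^+ S (sigmaR T)
  = (qfact qL #|LV B| * qfact qR #|RV B|)
    / ((\prod_(U : LV B) qint qL (E U)) * (\prod_(U : RV B) qint qR (E U))).
Proof.
rewrite -mulf_div -(sum_labellings lft B (qint_mpolyX_neq0 ord0) S_stat).
rewrite -(sum_labellings rgt B (qint_mpolyX_neq0 ord_max) S_stat).
(* Membership in [NAT B] constrains each labelling separately, so the product of the two sums
   expands into the sum over pairs. *)
rewrite big_distrlr pair_big /=; apply: eq_bigl => T.
by rewrite inE.
Qed.
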